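(* Let $\Phi:[0,\ell(I)[\,\to\mathbb{R}_+$ and $f:I\to\mathbb{R}$ be locally Lebesgue integrable functions. If $f$ is $\Phi$-monotone, then, for all $u,v,w,z\in I$ with $u\le w$ and $v\le z$, $$\mathscr{A}(f,\langle u,v\rangle)\le\mathscr{A}(f,\langle w,z\rangle)+\mathscr{A}(\Phi,\langle w-u,z-v\rangle).$$ If $f$ is $\Phi$-Hölder, then, for all $u,v,w,z\in I$, $$\big|\mathscr{A}(f,\langle u,v\rangle)-\mathscr{A}(f,\langle w,z\rangle)\big|\le\mathscr{A}(\Phi\circ|\cdot|,\langle w-u,z-v\rangle).$$
   Context: $I$ is a nonempty open real interval and $\ell(I)\in\,]0,\infty]$ is its length; $\mathbb{R}_+=[0,\infty[$. A function on an interval is locally (Lebesgue) integrable if it has a finite Lebesgue integral over every compact subinterval of its domain. $f:I\to\mathbb{R}$ is $\Phi$-monotone if $f(x)\le f(y)+\Phi(y-x)$ for all $x,y\in I$ with $x\le y$; it is $\Phi$-Hölder if $|f(x)-f(y)|\le\Phi(|x-y|)$ for all $x,y\in I$. For reals $a,b$, $\langle a,b\rangle$ denotes the smallest interval containing $a$ and $b$ (so $[a,b]$, $\{a\}$ or $[b,a]$ according to whether $a<b$, $a=b$ or $a>b$). For a Lebesgue integrable $g:\langle a,b\rangle\to\mathbb{R}$, the integral average is $$\mathscr{A}(g,\langle a,b\rangle):=\int_0^1 g(ta+(1-t)b)\,dt,$$ which equals $g(a)$ if $a=b$ and $\frac{1}{|b-a|}\int_{\min(a,b)}^{\max(a,b)}g$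 otherwise. $\Phi\circ|\cdot|$ is the function $t\mapsto\Phi(|t|)$ on $]-\ell(I),\ell(I)[$. *)

(* Defs.v *)
From HB Require Import structures.
From mathcomp Require Import all_boot all_order all_algebra.
From mathcomp Require Import all_classical all_reals all_analysis.

Set Implicit Arguments.
Unset Strict Implicit.
Unset Printing Implicit Defensive.

Import Order.TTheory GRing.Theory Num.Theory.
Import numFieldNormedType.Exports.

Local Open Scope classical_set_scope.
Local Open Scope ring_scope.

(* A function on a subset D of R is represented by a total function R -> R of
   which only the values on D are constrained and used.

   Integrals are taken with respect to [completed_lebesgue_measure], whose
   sigma-algebra is that of all Lebesgue measurable sets; [lebesgue_measure]
   only knows Borel sets, and would restrict integrable functions to Borel
   ones. *)

Definition open_interval (R : realType) (I : set R) : Prop :=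
  [/\ is_interval I, open I & I !=set0].

(* [wlength idfun I] is sup I - inf I, in the extended reals. *)
Definition itv_length (R : realType) (I : set R) : \bar R := wlength idfun I.

(* [0, l[, where l may be +oo *)
Definition co_zero (R : realType) (l : \bar R) : set R :=
  [set t | 0 <= t /\ (t%:E < l)%E].

Definition lebesgue_locally_integrable (R : realType) (D : set R) (g : R -> R)
  : Prop :=
  forall c d : R, c <= d -> `[c, d] `<=` D ->
    (@completed_lebesgue_measure R).-integrable `[c, d] (EFin \o g).

Definition Phi_monotone (R : realType) (I : set R) (Phi f : R -> R) : Prop :=
  forall x y : R, I x -> I y -> x <= y -> f x <= f y + Phi (y - x).

Definition Phi_holder (R : realType) (I : set R) (Phi f : R -> R) : Prop :=
  forall x y : R, I x -> I y -> `|f x - f y| <= Phi `|x - y|.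

(* The average of g over <a, b>, the smallest interval containing a and b (in
   either order); all the points t a + (1 - t) b lie in it. *)
Definition integral_average (R : realType) (g : R -> R) (a b : R) : R :=
  Rintegral (@completed_lebesgue_measure R) `[0, 1]
    (fun t : R => g (t * a + (1 - t) * b)).

(* Main.v *)
(* Averaging the defining inequality over t in [0, 1]: the points
   x = t u + (1 - t) v and y = t w + (1 - t) z belong to I and
   y - x = t (w - u) + (1 - t) (z - v), so f x <= f y + Phi (y - x) (resp.
   |f x - f y| <= Phi |x - y|) integrates to the claim.  The work lies in the
   integrability of the three integrands, that is, in the stability of Lebesgue
   (not just Borel) integrability under nonconstant affine substitutions: such
   a substitution scales the Lebesgue outer measure by a constant, hence
   preserves Caratheodory measurability. *)
Require Import Defs.
From HB Require Import structures.
From mathcomp Require Import all_boot all_order all_algebra.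
From mathcomp Require Import all_classical all_reals all_analysis.
From mathcomp Require Import measurable_realfun ring lra.

Set Implicit Arguments.
Unset Strict Implicit.
Unset Printing Implicit Defensive.

Import Order.TTheory GRing.Theory Num.Theory.
Import numFieldNormedType.Exports.

Local Open Scope classical_set_scope.
Local Open Scope ring_scope.

(** * Scaling of Lebesgue measure under affine maps *)

Section affine_preimage.
Context {R : realType}.
Variables k c : R.
Hypothesis k0 : k != 0.
Local Notation aff := (fun t : R => k * t + c).
Local Notation outer := ((@wlength R idfun)^*)%mu.

Lemma measurable_affine : measurable_fun [set: measurableTypeR R]
  (aff : measurableTypeR R -> measurableTypeR R).
Proof.
apply: (@measurable_funD _ _ R setT (fun t => k * t) (cst c)) => //.
exact: mulrl_measurable.
Qed.

(** Uniqueness of Lebesgue measure: [|k|] times its pushforward by [aff] is a measure, so agreement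
    on the intervals []a, b]] suffices. *)
Lemma lebesgue_measure_affine (A : set (measurableTypeR R)) : measurable A ->
  (lebesgue_measure A = `|k|%:E * lebesgue_measure (aff @^-1` A))%E.
Proof.
have gt0 : 0 < `|k| by rewrite normr_gt0.
pose phi : measurableTypeR R -> measurableTypeR R := aff.
have mphi : measurable_fun setT phi := measurable_affine.
pose nu := mscale (NngNum (ltW gt0)) (pushforward (@lebesgue_measure R) phi).
move=> mA; rewrite [RHS](_ : _ = nu mphi A)//.
apply: (@lebesgue_measure_unique R (nu mphi)) => // _ [[a b]] _ <-.
rewrite [RHS](_ : _ =
  (`|k|%:E * lebesgue_measure (phi @^-1` `]a, b]%classic))%E)//.
have [kp|kn] := ltP 0 k.
- rewrite [X in (_ * lebesgue_measure X)%E](_ : _ =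
    `](a - c) / k, (b - c) / k]%classic); last first.
    apply/seteqP; split => x; rewrite /phi /= !in_itv/=;
      rewrite ltr_pdivrMr// ler_pdivlMr//; lra.
  rewrite !lebesgue_measure_itv/= !lte_fin ltr_pM2r ?invr_gt0// ltrD2r.
  case: ifP => _; last by rewrite mule0.
  by rewrite -!EFinD -EFinM (gtr0_norm kp); congr EFin; field.
- have {}kn : k < 0 by rewrite lt_neqAle k0.
  (* A negative slope reverses the interval, so the preimage is closed on the left and open on the
     right. *)
  rewrite [X in (_ * lebesgue_measure X)%E](_ : _ =
    `[(b - c) / k, (a - c) / k[%classic); last first.
    apply/seteqP; split => x; rewrite /phi /= !in_itv/=;
      rewrite ltr_ndivlMr// ler_ndivrMr//; lra.
  rewrite !lebesgue_measure_itv/= !lte_fin ltr_nM2r ?invr_lt0// ltrD2r.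
  case: ifP => _; last by rewrite mule0.
  by rewrite -!EFinD -EFinM (ltr0_norm kn); congr EFin; field.
Qed.

(** An arbitrary set lies in a G-delta set of the same outer measure. That set is Borel, so its
    measure scales exactly, and monotonicity leaves one inequality. *)
Lemma outer_measure_affine_le (A : set R) :
  (`|k|%:E * outer (aff @^-1` A) <= outer A)%E.
Proof.
have [G [oG AG <-]] := outer_measure_Gdelta A.
rewrite [leRHS]lebesgue_measure_affine; last first.
  by apply: bigcapT_measurable => i; exact: open_measurable.
by rewrite lee_wpmul2l// le_outer_measure//; exact: preimage_subset.
Qed.

End affine_preimage.

(** * Affine substitution in Lebesgue measurable functions *)

Section completed_affine_preimage.
Context {R : realType}.
Variables k c : R.
Hypothesis k0 : k != 0.
Local Notation aff := (fun t : R => k * t + c).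
Local Notation inv_aff := (fun t : R => k^-1 * t - k^-1 * c).
Local Notation outer := ((@wlength R idfun)^*)%mu.
Local Notation cmu := (@completed_lebesgue_measure R).

Let inv_affK (A : set R) : aff @^-1` (inv_aff @^-1` A) = A.
Proof.
by apply/seteqP; split => x /=; rewrite -mulrBr addrK mulKf.
Qed.

Let affK (A : set R) : inv_aff @^-1` (aff @^-1` A) = A.
Proof.
by apply/seteqP; split => x /=; rewrite -mulrBr mulVKf// subrK.
Qed.

Lemma outer_measure_affine (A : set R) :
  (outer A = `|k|%:E * outer (aff @^-1` A))%E.
Proof.
apply/eqP; rewrite eq_le outer_measure_affine_le// andbT.
have kV0 : k^-1 != 0 by rewrite invr_eq0.
have := outer_measure_affine_le (- (k^-1 * c)) kV0 (aff @^-1` A).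
rewrite affK normfV => h.
have := @lee_wpmul2l _ `|k|%:E _ _ _ h.
by rewrite muleA -EFinM mulfV ?normr_eq0// mul1e; apply; rewrite lee_fin.
Qed.

Lemma measurable_completed_affine : measurable_fun
  [set: caratheodory_type outer]
  (aff : caratheodory_type outer -> caratheodory_type outer).
Proof.
move=> _ A mA; rewrite setTI; apply: le_caratheodory_measurable => X.
have ak0 : (0 < `|k|%:E)%E by rewrite lte_fin normr_gt0.
rewrite -(lee_pmul2l _ ak0)// ge0_muleDr//.
rewrite -[X in X `&` _]inv_affK.
rewrite -[X in (_ + `|k|%:E * outer (X `&` _))%E]inv_affK.
rewrite preimage_setC -!preimage_setI -!outer_measure_affine.
rewrite -(mA (inv_aff @^-1` X)) -(inv_affK X) -outer_measure_affine.
by rewrite inv_affK.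
Qed.

(** Change of variables: the pushforward of [cmu] by [aff] is [|k|^-1] times [cmu], so the integral
    of the absolute value stays finite. *)
Lemma integrable_completed_affine (D : set R) (g : R -> R) :
  measurable (D : set (caratheodory_type outer)) ->
  cmu.-integrable D (EFin \o g) ->
  cmu.-integrable (aff @^-1` D) (EFin \o (g \o aff)).
Proof.
have ak0 : 0 < `|k|^-1 by rewrite invr_gt0 normr_gt0.
pose phi : caratheodory_type outer -> caratheodory_type outer := aff.
have mphi : measurable_fun setT phi := measurable_completed_affine.
move=> mD /integrableP[mg goo]; apply/integrableP; split.
  apply: (@measurable_comp _ _ _ (caratheodory_type outer)
    (caratheodory_type outer) (\bar R) D (EFin \o g) _ phi).
  - exact: mD.
  - by move=> _ [x Dx <-].
  - exact: mg.
  - exact: measurable_funTS mphi.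
rewrite -(@ge0_integral_pushforward _ _ _ _ _ phi mphi cmu D
  (abse \o (EFin \o g))) //.
- pose nu := mscale (NngNum (ltW ak0)) cmu.
  rewrite (@eq_measure_integral _ _ _ _ nu).
    rewrite ge0_integral_mscale//=.
    + by rewrite lte_mul_pinfty// lee_fin ltW.
    + exact: measurableT_comp.
  move=> A _ _.
  change (outer (aff @^-1` A) = (`|k|^-1)%:E * outer A)%E.
  rewrite (outer_measure_affine A).
  by rewrite muleA -EFinM mulVf ?normr_eq0// mul1e.
- exact: measurableT_comp.
- by move=> y _; exact: abse_ge0.
Qed.

End completed_affine_preimage.

(** * Integrability of the averaged functions *)

Section integral_average_theory.
Context {R : realType}.
Local Notation cmu := (@completed_lebesgue_measure R).
Implicit Types (I : set R) (Phi f g : R -> R) (a b l m : R).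

Lemma completed_measurable_itv (i : interval R) :
  measurable ([set` i] : set (caratheodory_type ((@wlength R idfun)^*)%mu)).
Proof. exact: sub_caratheodory (measurable_itv i). Qed.

Lemma completed_measure_unit : cmu `[0, 1] = 1%:E.
Proof.
have := @lebesgue_measure_itv R `[0, 1].
by rewrite /= lte_fin ltr01 sube0.
Qed.

Lemma convex_combination_between (t a b : R) : 0 <= t <= 1 ->
  Num.min a b <= t * a + (1 - t) * b <= Num.max a b.
Proof.
move=> /andP[t0 t1]; rewrite ge_min le_max.
have [ab|ba] := leP a b.
  by apply/andP; split; apply/orP; [left|right]; nra.
by apply/andP; split; apply/orP; [right|left]; nra.
Qed.

(** For [a != b] the substitution is affine in [t] with slope [a - b], and the preimage of the
    interval between [a] and [b] contains [[0, 1]]. For [a = b] the integrand is constant. *)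
Lemma integrable_average g a b :
  cmu.-integrable `[Num.min a b, Num.max a b] (EFin \o g) ->
  cmu.-integrable `[0, 1] (EFin \o (fun t => g (t * a + (1 - t) * b))).
Proof.
move=> ig; have [<-|ab] := eqVneq a b.
  have -> : EFin \o (fun t => g (t * a + (1 - t) * a)) = cst (g a)%:E.
    by apply/funext => t /=; congr (g _)%:E; ring.
  have m01 := completed_measurable_itv `[0, 1].
  apply/integrableP; split; first exact: measurable_cst.
  rewrite (@integral_cst _ _ _ _ _ m01 `|(g a)%:E|%E).
  by rewrite [X in (_ * X)%E]completed_measure_unit mule1 ltry.
have k0 : a - b != 0 by rewrite subr_eq0.
have /(_ (completed_measurable_itv _) ig) :=
  @integrable_completed_affine R (a - b) b k0 `[Num.min a b, Num.max a b] g.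
set E := _ @^-1` _ => ih.
have -> : EFin \o (fun t => g (t * a + (1 - t) * b)) =
    EFin \o (g \o (fun t => (a - b) * t + b)).
  by apply/funext => t /=; congr (g _)%:E; ring.
apply: integrableS ih.
- have := @measurable_completed_affine R _ b k0 measurableT _
    (completed_measurable_itv `[Num.min a b, Num.max a b]).
  by rewrite setTI.
- exact: completed_measurable_itv.
- move=> t; rewrite /E /= !in_itv/= => /convex_combination_between.
  by rewrite (_ : (a - b) * t + b = t * a + (1 - t) * b)//; ring.
Qed.

Lemma integrable_comp_norm g m :
  cmu.-integrable `[0, m] (EFin \o g) ->
  cmu.-integrable `[- m, m] (EFin \o (fun t => g `|t|)).
Proof.
(* On [- m, m], g |t| = p t + q (- t), with p and q the extensions by 0 of the
   restrictions of g to [0, m] and ]0, m]. *)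
move=> ig.
have mI i := completed_measurable_itv i.
have igT (i : interval R) : [set` i] `<=` `[0, m] ->
    cmu.-integrable setT (EFin \o (g \_ [set` i])).
  move=> im; rewrite -restrict_EFin; apply/(integrable_mkcond _ (mI i)).
  exact: integrableS (mI _) (mI _) im ig.
have ip := igT `[0, m] (@subset_refl _ _).
(* Excluding 0 here keeps [g 0] from being counted twice at [t = 0]. *)
have iq : cmu.-integrable setT
    (EFin \o ((g \_ `]0, m]) \o (fun t => - 1 * t + 0))).
  rewrite -[setT](preimage_setT (fun t => - 1 * t + 0)).
  apply: (@integrable_completed_affine R (- 1) 0); rewrite ?oppr_eq0//.
  by apply: igT => t /=; rewrite !in_itv/= => /andP[/ltW -> ->].
have := integrableS measurableT (mI `[- m, m]) (@subsetT _ _)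
  (integrableD measurableT ip iq).
apply: eq_integrable => // t; rewrite inE/= in_itv/= => /andP[mt tm].
rewrite -EFinD mulN1r addr0 /patch !mem_setE !in_itv/=; congr EFin.
rewrite oppr_gt0.
have [t0|t0] := leP 0 t; first by rewrite tm/= addr0 (ger0_norm t0).
by rewrite lerNl mt/= add0r (ltr0_norm t0).
Qed.

(** The strict bound comes from openness: [I] extends beyond the larger point by some [e / 2], so
    its length exceeds the distance by at least that much. *)
Lemma co_zero_dist I x y : open_interval I -> I x -> I y ->
  co_zero (itv_length I) `|x - y|.
Proof.
move=> [itvI oI _]; wlog xy : x y / x <= y.
  move=> ih Ix Iy; have [|/ltW yx] := leP x y; first by move=> xy; exact: ih.
  by rewrite distrC; exact: ih.
move=> Ix Iy; split; first exact: normr_ge0.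
have /nbhs_ballP[e /= e0 eI] : nbhs y I by exact: open_nbhs_nbhs.
have Iye : I (y + e / 2).
  apply: eI; rewrite /ball/= opprD addNKr normrN gtr0_norm ?divr_gt0//.
  by rewrite ltr_pdivrMr// ltr_pMr// ltr1n.
have xye : x <= y + e / 2 by rewrite (le_trans xy)// lerDl divr_ge0// ltW.
have sub : `[x, y + e / 2] `<=` I.
  by move=> t /=; rewrite in_itv/=; exact: itvI.
have id_nd : {homo (@idfun R) : x y / x <= y} by [].
apply: lt_le_trans (le_wlength id_nd sub).
rewrite wlength_itv_bnd//= lte_fin ler0_norm ?subr_le0//.
by rewrite opprB ltrBDr subrK ltrDl divr_gt0.
Qed.

Lemma co_zero_itv (l : \bar R) a b : 0 <= a -> co_zero l b ->
  `[a, b] `<=` co_zero l.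
Proof.
move=> a0 [b0 bl] t /=; rewrite in_itv/= => /andP[at_ tb].
by split; [exact: le_trans at_|apply: le_lt_trans bl; rewrite lee_fin].
Qed.

Lemma co_zero_max (l : \bar R) a b : co_zero l a -> co_zero l b ->
  co_zero l (Num.max a b).
Proof. by move=> la lb; have [] := leP a b. Qed.

Lemma interval_convex_combination I t a b : is_interval I -> I a -> I b ->
  0 <= t <= 1 -> I (t * a + (1 - t) * b).
Proof.
move=> itvI Ia Ib /(convex_combination_between a b); apply: itvI.
- by have [] := leP a b.
- by have [] := leP a b.
Qed.

(** Stated for any interval because it serves both [f] on [I] and [Phi] on
    [co_zero (itv_length I)]. *)
Lemma interval_integrable_average I f a b : is_interval I ->
  lebesgue_locally_integrable I f -> I a -> I b ->
  cmu.-integrable `[0, 1] (EFin \o (fun t => f (t * a + (1 - t) * b))).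
Proof.
move=> itvI f_int Ia Ib; apply: integrable_average; apply: f_int.
  by rewrite ge_min !le_max lexx.
move=> t /=; rewrite in_itv/=; apply: itvI.
- by have [] := leP a b.
- by have [] := leP a b.
Qed.

Lemma co_zero_is_interval (l : \bar R) : is_interval (@co_zero R l).
Proof.
move=> a b [a0 _] lb t abt; apply: (co_zero_itv a0 lb).
by rewrite /= in_itv.
Qed.

End integral_average_theory.

Theorem theorem5p1 (R : realType) (I : set R) (Phi f : R -> R)
    (HI : open_interval I)
    (Phi_ge0 : forall t : R, co_zero (itv_length I) t -> 0 <= Phi t)
    (Phi_int : lebesgue_locally_integrable (co_zero (itv_length I)) Phi)
    (f_int : lebesgue_locally_integrable I f) :
  (Phi_monotone I Phi f ->
    forall u v w z : R, I u -> I v -> I w -> I z -> u <= w -> v <= z ->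
      integral_average f u v <=
      integral_average f w z + integral_average Phi (w - u) (z - v)) /\
  (Phi_holder I Phi f ->
    forall u v w z : R, I u -> I v -> I w -> I z ->
      `|integral_average f u v - integral_average f w z| <=
      integral_average (fun t : R => Phi `|t|) (w - u) (z - v)).
Proof.
have itvI : is_interval I by case: HI.
have m01 := @completed_measurable_itv R `[0, 1].
have f_avg := interval_integrable_average itvI f_int.
split=> [f_mono u v w z Iu Iv Iw Iz uw vz|f_holder u v w z Iu Iv Iw Iz].
- have Dwu : co_zero (itv_length I) (w - u).
    by rewrite -(ger0_norm (_ : 0 <= w - u)) ?subr_ge0//; exact: co_zero_dist.
  have Dzv : co_zero (itv_length I) (z - v).
    by rewrite -(ger0_norm (_ : 0 <= z - v)) ?subr_ge0//; exact: co_zero_dist.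
  have iPhi := interval_integrable_average (@co_zero_is_interval R _) Phi_int
    Dwu Dzv.
  rewrite /integral_average -RintegralD//; [|exact: f_avg..].
  apply: le_Rintegral => //; first exact: f_avg.
    by apply: (integrableD m01 (f_avg _ _ Iw Iz) iPhi).
  move=> t; rewrite /= in_itv/= => t01; have /andP[t0 t1] := t01.
  have := f_mono (t * u + (1 - t) * v) (t * w + (1 - t) * z).
  rewrite (_ : t * w + (1 - t) * z - _ = t * (w - u) + (1 - t) * (z - v));
    last by ring.
  apply; [exact: interval_convex_combination..|].
  by rewrite lerD// ler_wpM2l// subr_ge0.
(* The increments may now have any sign: both lie in the symmetric interval [[- m, m]], and [m] is
   still below the length of [I]. *)
- pose m := Num.max `|w - u| `|z - v|.
  have Dm : co_zero (itv_length I) m.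
    by apply: co_zero_max; exact: co_zero_dist.
  have iPhi : (@completed_lebesgue_measure R).-integrable `[0, 1]
      (EFin \o (fun t => Phi `|t * (w - u) + (1 - t) * (z - v)|)).
    have iPhim : (@completed_lebesgue_measure R).-integrable `[- m, m]
        (EFin \o (fun t => Phi `|t|)).
      apply: integrable_comp_norm; apply: Phi_int; first by case: Dm.
      exact: co_zero_itv.
    apply: (@integrable_average R (fun t => Phi `|t|)).
    apply: integrableS iPhim; [exact: completed_measurable_itv..|].
    apply: subset_itv; rewrite bnd_simp/=.
    + by rewrite le_min; apply/andP; split; apply: lerNnormlW;
        rewrite le_max lexx ?orbT.
    + by rewrite ge_max; apply/andP; split; apply: ler_normlW;
        rewrite le_max lexx ?orbT.
  (* The difference of averages is the average of the difference, whose absolute value passes under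
     the integral before the pointwise bound is used. *)
  rewrite /integral_average -RintegralB//; [|exact: f_avg..].
  have ifB := integrableB m01 (f_avg _ _ Iu Iv) (f_avg _ _ Iw Iz).
  apply: (le_trans (le_normr_Rintegral m01 ifB)).
  apply: le_Rintegral => //; first exact: integrable_norm.
  move=> t; rewrite /= in_itv/= => t01.
  have := f_holder (t * u + (1 - t) * v) (t * w + (1 - t) * z).
  rewrite [in X in Phi X]distrC.
  rewrite (_ : t * w + (1 - t) * z - _ = t * (w - u) + (1 - t) * (z - v));
    last by ring.
  by apply; exact: interval_convex_combination.
Qed.
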